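(* For every integer $n\ge 3$ and every odd integer $q\ge 3$, there exists an automata network $F:Q^n\to Q^n$ with $Q=\{0,\dots,q-1\}$, of degree at most $\lceil 2n/3\rceil$, whose rank is $q^n-2$.
   Context: An automata network is a map $F:Q^V\to Q^V$, $V=\{1,\dots,n\}$, with local functions $f_j(x)=F(x)_j$. Its interaction graph has an arc $(i,j)$ iff $f_j$ effectively depends on $x_i$ (there exist $x,x'$ differing only at $i$ with $f_j(x)\neq f_j(x')$). The degree of $F$ is the maximum in-degree of its interaction graph. The rank of $F$ is $|F(Q^V)|$. *)

(* Defs.v *)
From mathcomp Require Import all_boot all_order all_algebra.

Set Implicit Arguments.
Unset Strict Implicit.
Unset Printing Implicit Defensive.

Definition network (V Q : finType) : Type := {ffun V -> Q} -> {ffun V -> Q}.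

Section Network.

Variables (V Q : finType) (F : network V Q).

(* The local function f_j is [fun x => F x j]. *)
Definition interaction_graph : rel V := fun i j =>
  [exists x : {ffun V -> Q}, [exists x' : {ffun V -> Q},
    [forall k, (k != i) ==> (x k == x' k)] && (F x j != F x' j)]].

Definition in_degree (j : V) : nat := #|[set i | interaction_graph i j]|.

Definition degree : nat := \max_(j : V) in_degree j.

Definition rank : nat := #|F @: [set: {ffun V -> Q}]|.

End Network.

(* Main.v *)
(** Single out three coordinates [a], [b], [c] and cover the coordinates by two
    sets [A], [B] of about [n/2] elements with [A :&: B = [set b]], [a] in [A]
    and [c] in [B].  As [q] is odd, the map [L] sending
    [(x_a, x_b, x_c)] to [(x_a + x_b, x_b + x_c, x_c + x_a)] and fixing the
    other coordinates is a bijection, with [L dA = 2 unitf a] and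
    [L dB = 2 unitf b] for [dA = (1, 1, -1)] and [dB = (-1, 1, 1)].  Hence
    composing [L] with the exchange [sigma] of the subcubes [x = 0 on A] and
    [x = dA on A], by translation along [dA], changes only coordinate [a] of
    [L x], and by an amount that depends only on [x] on [A]; the same holds for
    the exchange [tau] of two subcubes over [B] translated along [dB], and
    coordinate [b].  The network adds both changes to [L x].  It agrees with
    the bijection [G = L o sigma o tau] unless [tau] moves [x] into or out of a
    subcube exchanged by [sigma], that is, except at the two points
    [e = (1, 1, 1)] and [tau e], where its values are taken by [G] at other points (all
    vectors being extended by 0). *)

Require Import Defs.
From mathcomp Require Import all_boot all_order all_algebra.
From mathcomp Require Import zify ring lra.
Local Open Scope ring_scope.

Set Implicit Arguments.
Unset Strict Implicit.
Unset Printing Implicit Defensive.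

Import GRing.Theory Num.Theory.

(** * Bounding in-degrees, ranks and interval sizes *)

Lemma in_degree_le (V Q : finType) (F : network V Q) (j : V) (S : {set V}) :
  (forall x y : {ffun V -> Q}, {in S, x =1 y} -> F x j = F y j) ->
  (in_degree F j <= #|S|)%N.
Proof.
move=> FS; apply/subset_leq_card/subsetP => i; rewrite inE.
case/existsP=> x /existsP[y /andP[/forallP xy /eqP Fxy]].
apply: contra_notT Fxy => iS; apply: FS => k kS.
by apply/eqP/(implyP (xy k)); apply: contraNneq iS => <-.
Qed.

(** An injective self-map of a finite type is onto, so [F a] and [F b], avoiding [G a] and [G b],
    are values of [G] at points other than [a] and [b]. The image of [F] is thus that of [G] with
    exactly [G a] and [G b] removed; [F a = F b] is harmless. *)
Lemma card_imset_two_changed (T : finType) (F G : T -> T) (a b : T) :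
  injective G -> a != b -> (forall x, x != a -> x != b -> F x = G x) ->
  F a \notin [:: G a; G b] -> F b \notin [:: G a; G b] ->
  #|F @: [set: T]| = (#|T| - 2)%N.
Proof.
move=> Ginj ab FG Fa Fb.
suff -> : F @: [set: T] = G @: (~: [set a; b]).
  by rewrite card_imset // cardsCs setCK cards2 ab.
apply/setP/subset_eqP/andP.
split; apply/subsetP => y /imsetP[x xab ->]; last first.
  by move: xab; rewrite !inE negb_or => /andP[xa xb]; rewrite -FG ?imset_f.
have: F x \notin [:: G a; G b].
  have [-> // | xa] := eqVneq x a; have [-> // | xb] := eqVneq x b.
  by rewrite FG // !inE !(inj_eq Ginj) negb_or xa.
have [g _ gK] := injF_bij Ginj; rewrite -[F x]gK => yab.
by apply: imset_f; move: yab; rewrite !inE !(inj_eq Ginj).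
Qed.

Lemma card_ord_itv (n l u : nat) :
  (#|[set i : 'I_n | (l <= i < u)%N]| <= u - l)%N.
Proof.
set S := [set i | _]; rewrite cardE -(size_map val) -(size_iota l (u - l)).
apply: uniq_leq_size; first by rewrite (map_inj_uniq val_inj) enum_uniq.
move=> _ /mapP[i + ->]; rewrite mem_enum inE mem_iota => /andP[li iu].
by rewrite li subnKC // ltnW // (leq_ltn_trans li).
Qed.

(** * Exchanging two parallel subcubes *)

Section Subcubes.

Variables (V : finType) (R : finComUnitRingType).
Implicit Types (S : {set V}) (v d x y : {ffun V -> R}).

Definition agree S x y := [forall i in S, x i == y i].

Lemma agreeP S x y : reflect {in S, x =1 y} (agree S x y).
Proof. exact: eqfun_inP. Qed.

Lemma agree_eq S x y v : {in S, x =1 y} -> agree S x v = agree S y v.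
Proof. by move=> xy; apply: eq_forallb_in => i /xy ->. Qed.

Lemma agreeD S x y d : agree S (x + d) (y + d) = agree S x y.
Proof. by apply: eq_forallb_in => i _; rewrite !ffunE (inj_eq (addIr _)). Qed.

Lemma agreeN S x v i : i \in S -> x i != v i -> agree S x v = false.
Proof. by move=> iS; apply: contraNF => /agreeP->. Qed.

Definition scalef (k : R) x : {ffun V -> R} := [ffun i => k * x i].
Local Notation "k ** x" := (scalef k x) (at level 40, left associativity).

Lemma scalef1 x : 1 ** x = x.
Proof. by apply/ffunP => i; rewrite ffunE mul1r. Qed.

Lemma scalef0 x : 0 ** x = 0.
Proof. by apply/ffunP => i; rewrite !ffunE mul0r. Qed.

Lemma scalefN k x : (- k) ** x = - (k ** x).
Proof. by apply/ffunP => i; rewrite !ffunE mulNr. Qed.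

Lemma scalefN1 x : (-1) ** x = - x.
Proof. by rewrite scalefN scalef1. Qed.

Lemma scalefA k l x : k ** (l ** x) = (k * l) ** x.
Proof. by apply/ffunP => i; rewrite !ffunE mulrA. Qed.

(** A difference of two indicators in [R], so that it visibly depends only on [x] restricted to [S];
    this is what bounds the degree later. *)
Definition swap_sign S v d x : R := (agree S x v)%:R - (agree S x (v + d))%:R.

Definition swap S v d x := x + swap_sign S v d x ** d.

Variables (S : {set V}) (v d : {ffun V -> R}) (i : V).
Hypotheses (iS : i \in S) (di0 : d i != 0).

Lemma agree_disjoint x : agree S x v -> agree S x (v + d) = false.
Proof.
move=> /agreeP xv; apply: (agreeN iS).
by rewrite xv // ffunE -subr_eq0 opprD addrA subrr sub0r oppr_eq0.
Qed.

Variant swap_spec x : R -> {ffun V -> R} -> Type :=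
| SwapUp of agree S x v : swap_spec x 1 (x + d)
| SwapDown of agree S x (v + d) : swap_spec x (-1) (x - d)
| SwapNone : swap_spec x 0 x.

Lemma swap_sign_up x : agree S x v -> swap_sign S v d x = 1.
Proof. by move=> xv; rewrite /swap_sign xv agree_disjoint ?subr0. Qed.

Lemma swap_sign_down x : agree S x (v + d) -> swap_sign S v d x = -1.
Proof.
move=> xv; rewrite /swap_sign xv.
case: (boolP (agree S x v)) => [/agree_disjoint | _].
  by rewrite xv.
by rewrite sub0r.
Qed.

Lemma swapP x : swap_spec x (swap_sign S v d x) (swap S v d x).
Proof.
rewrite /swap; case: (boolP (agree S x v)) => xv.
  by rewrite swap_sign_up // scalef1; constructor.
case: (boolP (agree S x (v + d))) => xvd.
  by rewrite swap_sign_down // scalefN1; constructor.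
rewrite /swap_sign (negPf xv) (negPf xvd) subr0 scalef0 addr0; constructor.
Qed.

(** Translation by [d] carries the first subcube onto the second and back, so the sign is reversed;
    hence [swap] undoes itself. *)
Lemma swap_sign_swap x :
  swap_sign S v d (swap S v d x) = - swap_sign S v d x.
Proof.
case: (boolP (agree S x v)) => xv.
  by rewrite /swap (swap_sign_up xv) scalef1 swap_sign_down ?agreeD.
case: (boolP (agree S x (v + d))) => xvd.
  rewrite /swap (swap_sign_down xvd) scalefN1 opprK swap_sign_up //.
  by rewrite -(agreeD _ _ _ d) subrK.
have sx0 : swap_sign S v d x = 0.
  by rewrite /swap_sign (negPf xv) (negPf xvd) subr0.
by rewrite /swap sx0 scalef0 addr0 sx0 oppr0.
Qed.

Lemma swapK : involutive (swap S v d).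
Proof. by move=> x; rewrite {1}/swap swap_sign_swap scalefN addrK. Qed.

End Subcubes.

Local Notation "k ** x" := (scalef k x) (at level 40, left associativity).

(** * The linear part and the network *)

Section Construction.

Variables (V : finType) (R : finComUnitRingType) (A B : {set V}) (a b c : V).
Hypotheses (unit2 : (2 : R) \is a GRing.unit).
Hypotheses (AUB : A :|: B = setT) (AIB : A :&: B = [set b]).
Hypotheses (aA : a \in A) (cB : c \in B) (ab : a != b) (cb : c != b).
Implicit Types (x y : {ffun V -> R}).

Definition unitf (i : V) : {ffun V -> R} := [ffun j => (j == i)%:R].

Let e := unitf a + unitf b + unitf c.
Let dA := e - 2 ** unitf c.
Let dB := e - 2 ** unitf a.

Let L x : {ffun V -> R} := [ffun i =>
  if i == a then x a + x b else if i == b then x b + x c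
  else if i == c then x c + x a else x i].

Let s := swap_sign A 0 dA.
Let t := swap_sign B e dB.

Definition two_swaps : network V R := fun x =>
  L x + (2 * s x) ** unitf a + (2 * t x) ** unitf b.

Lemma two_neq0 : (2 : R) != 0.
Proof. by apply: contraTneq unit2 => ->; rewrite unitr0. Qed.

Lemma bA : b \in A. Proof. by have := set11 b; rewrite -AIB inE => /andP[]. Qed.
Lemma bB : b \in B. Proof. by have := set11 b; rewrite -AIB inE => /andP[]. Qed.

Lemma cA : c \notin A.
Proof. by apply: contra cb => cA; rewrite -in_set1 -AIB inE cA. Qed.

Lemma ca : c != a. Proof. by apply: contraNneq cA => ->. Qed.

Lemma linear_part_inj : injective L.
Proof.
move=> x y /ffunP Lxy.
have := Lxy a; have := Lxy b; have := Lxy c.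
rewrite !ffunE !eqxx (eq_sym b a) (negPf ab) (negPf ca) (negPf cb) => hc hb ha.
have xa : x a = y a.
  apply: (mulrI unit2).
  (* The right-hand side is the alternating sum of coordinates [a], [b], [c] of [L z], so [L z]
     determines [z a] once 2 is invertible. *)
  have dbl (z : {ffun V -> R}) :
    2 * z a = (z a + z b) - (z b + z c) + (z c + z a) by ring.
  by rewrite !dbl ha hb hc.
have xb : x b = y b by move: ha; rewrite xa => /addrI.
have xc : x c = y c by move: hb; rewrite xb => /addrI.
apply/ffunP => i; have := Lxy i; rewrite !ffunE.
by do !case: eqVneq => [-> | _].
Qed.

Lemma linear_part_swap k x d i :
  L d = 2 ** unitf i -> L (x + k ** d) = L x + (2 * k) ** unitf i.
Proof.
move=> Ld; rewrite (mulrC 2) -scalefA -Ld; apply/ffunP => j; rewrite !ffunE.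
by do !case: ifP => _; ring.
Qed.

Lemma distinct_abc :
  ((a == b = false) * (b == a = false) * (a == c = false) *
   (c == a = false) * (b == c = false) * (c == b = false))%type.
Proof.
rewrite [a == c]eq_sym [b == c]eq_sym [b == a]eq_sym.
by rewrite (negPf ab) (negPf ca) (negPf cb).
Qed.

Lemma L_dA : L dA = 2 ** unitf a.
Proof.
apply/ffunP => j; rewrite !ffunE !eqxx !distinct_abc.
case: (eqVneq j a) => [ja | _]; first by rewrite ?ja ?distinct_abc /=; ring.
case: (eqVneq j b) => [jb | _] /=; first by ring.
by case: (eqVneq j c) => _ /=; ring.
Qed.

Lemma L_dB : L dB = 2 ** unitf b.
Proof.
apply/ffunP => j; rewrite !ffunE !eqxx !distinct_abc.
case: (eqVneq j a) => [ja | _]; first by rewrite ?ja ?distinct_abc /=; ring.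
case: (eqVneq j b) => [jb | _] /=; first by ring.
by case: (eqVneq j c) => _ /=; ring.
Qed.

(** * Comparison of the network with a bijection *)

Let sigma := swap A 0 dA.
Let tau := swap B e dB.
Let G x := L (sigma (tau x)).

Lemma dA_b : dA b = 1.
Proof. by rewrite !ffunE !eqxx !distinct_abc /=; ring. Qed.

Lemma dB_b : dB b = 1.
Proof. by rewrite !ffunE !eqxx !distinct_abc /=; ring. Qed.

Lemma e_b : e b = 1.
Proof. by rewrite !ffunE !eqxx !distinct_abc /=; ring. Qed.

(** [dA] and [e] differ only at [c], which lies outside [A]. *)
Lemma agree_A_dA x : agree A x (0 + dA) = agree A x e.
Proof.
apply: eq_forallb_in => i iA; rewrite !ffunE.
have /negPf-> : i != c by apply: contraNneq cA => <-.
by rewrite /= !(mulr0, subr0, addr0, add0r).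
Qed.

Lemma sA_eq0 x : x b != 0 -> x b != 1 -> s x = 0.
Proof.
move=> x0 x1; rewrite /s /swap_sign !(agreeN bA) ?subrr //.
  by rewrite ffunE dA_b ffunE add0r.
by rewrite ffunE.
Qed.

Lemma dA_b_neq0 : dA b != 0. Proof. by rewrite dA_b oner_neq0. Qed.
Lemma dB_b_neq0 : dB b != 0. Proof. by rewrite dB_b oner_neq0. Qed.

Lemma two_neq1 : (2 : R) != 1.
Proof. by rewrite -subr_eq0 (_ : 2 - 1 = 1 :> R) ?oner_neq0 //; ring. Qed.

Lemma sigma_tau_inj : injective G.
Proof.
move=> x y /linear_part_inj /(can_inj (swapK _ bA dA_b_neq0)).
exact: (can_inj (swapK _ bB dB_b_neq0)).
Qed.

Lemma L_sigma x : L (sigma x) = L x + (2 * s x) ** unitf a.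
Proof. exact/linear_part_swap/L_dA. Qed.

Lemma L_tau x : L (tau x) = L x + (2 * t x) ** unitf b.
Proof. exact/linear_part_swap/L_dB. Qed.

(** [two_swaps] has the same formula with [s x] for [s (tau x)], so the two maps agree wherever
    [tau] preserves [s]. *)
Lemma GE x : G x = L x + (2 * t x) ** unitf b + (2 * s (tau x)) ** unitf a.
Proof. by rewrite /G L_sigma L_tau. Qed.

Lemma agree_AB x : agree A x e -> agree B x e -> x = e.
Proof.
move=> /agreeP xA /agreeP xB; apply/ffunP => i.
have /setUP[/xA // | /xB //] : i \in A :|: B by rewrite AUB inE.
Qed.

Lemma tau_e : tau e = e + dB.
Proof.
rewrite /tau /swap (swap_sign_up bB dB_b_neq0) ?scalef1 //.
exact/agreeP.
Qed.

Lemma tau_tau_e : tau (e + dB) = e.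
Proof. by rewrite -tau_e /tau (swapK _ bB dB_b_neq0). Qed.

(** Points moved by [tau] have [b]-coordinate 1 or 2. At 2, [s] vanishes, since the subcubes of
    [sigma] have [b]-coordinates 0 and 1. At 1, the point agrees with [e] on [B], so a nonzero [s]
    would force agreement on [A] too, hence equality with [e]. *)
Lemma s_tau x : x != e -> x != e + dB -> s (tau x) = s x.
Proof.
have sA_at_e y : y b = 1 -> y != e -> agree B y e -> s y = 0.
  move=> yb ye yB; rewrite /s /swap_sign agree_A_dA (agreeN bA) ?sub0r.
    suff -> : agree A y e = false by rewrite oppr0.
    by apply: contraNF ye => yA; rewrite (agree_AB yA yB).
  by rewrite yb ffunE oner_neq0.
move=> xe xr; rewrite /tau; case: (swapP _ bB dB_b_neq0 x) => // xB.
  rewrite (sA_at_e x) //; last by rewrite (agreeP _ _ _ xB) ?bB ?e_b.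
  by rewrite sA_eq0 // ffunE dB_b (agreeP _ _ _ xB) ?bB ?e_b ?two_neq0 ?two_neq1.
have xb : x b = 2.
  by rewrite (agreeP _ _ _ xB) ?bB // ffunE e_b dB_b.
rewrite [RHS]sA_eq0 ?xb ?two_neq0 ?two_neq1 // sA_at_e //.
- by rewrite ffunE xb [X in _ + X]ffunE dB_b; ring.
- by rewrite subr_eq.
by rewrite -(agreeD _ _ _ dB) subrK.
Qed.

Lemma rank_two_swaps : rank two_swaps = (#|R| ^ #|V| - 2)%N.
Proof.
have [n2 u2] := (two_neq0, two_neq1).
have se : s e = -1.
  by apply: (swap_sign_down bA dA_b_neq0); rewrite agree_A_dA; apply/agreeP.
have te : t e = 1 by apply: (swap_sign_up bB dB_b_neq0); apply/agreeP.
have tr : t (e + dB) = -1 by apply: (swap_sign_down bB dB_b_neq0); apply/agreeP.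
have sr : s (e + dB) = 0 by rewrite sA_eq0 // ffunE e_b dB_b.
have Lr : L (e + dB) = L e + 2 ** unitf b by rewrite -tau_e L_tau te mulr1.
have neq_at i (x y : {ffun V -> R}) : x i != y i -> x != y.
  by apply: contra_neq => ->.
rewrite /rank (card_imset_two_changed (G := G) (a := e) (b := e + dB)) ?card_ffun //.
- exact: sigma_tau_inj.
- rewrite eq_sym -[X in _ != X]addr0 (inj_eq (addrI _)).
  by apply: (neq_at b); rewrite dB_b ffunE oner_neq0.
- by move=> x xe xr; rewrite GE s_tau // addrAC.
(* Put r = [e + dB]. Relative to [L e], in coordinates ([a], [b]), the network takes the values (-2,
   2) at [e] and (0, 0) at r, while [G] takes (0, 2) and (-2, 0). Each value of the network differs
   from each of [G] in a coordinate where the difference is 2 up to sign. *)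
- rewrite !inE !GE tau_tau_e tau_e se te tr sr Lr /two_swaps se te negb_or.
  apply/andP; split.
    apply: (neq_at a); rewrite eq_sym !(ffunE, eqxx, distinct_abc) /= -subr_eq0.
    by apply: contraNneq n2 => <-; apply/eqP; ring.
  apply: (neq_at b); rewrite !(ffunE, eqxx, distinct_abc) /= -subr_eq0.
  by apply: contraNneq n2 => <-; apply/eqP; ring.
rewrite !inE !GE tau_tau_e tau_e se te tr sr Lr /two_swaps sr tr Lr negb_or.
apply/andP; split.
  apply: (neq_at b); rewrite eq_sym !(ffunE, eqxx, distinct_abc) /= -subr_eq0.
  by apply: contraNneq n2 => <-; apply/eqP; ring.
apply: (neq_at a); rewrite !(ffunE, eqxx, distinct_abc) /= -subr_eq0.
by apply: contraNneq n2 => <-; apply/eqP; ring.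
Qed.

(** Since [s] is taken at [x] and not at [tau x], output [a] reads only [A] and output [b] only
    [B]. *)
Lemma degree_two_swaps : (degree two_swaps <= maxn #|A| #|B|)%N.
Proof.
apply/bigmax_leqP => j _.
have le_max (S : {set V}) : (#|S| <= #|A|)%N || (#|S| <= #|B|)%N ->
    (forall x y : {ffun V -> R},
      {in S, x =1 y} -> two_swaps x j = two_swaps y j) ->
    (in_degree two_swaps j <= maxn #|A| #|B|)%N.
  by move=> leS /in_degree_le /leq_trans-> //; rewrite leq_max.
have [ja | na] := eqVneq j a.
  apply: (le_max A); rewrite ?leqnn // => x y xy.
  rewrite ja !(ffunE, eqxx, distinct_abc) /= !mulr0 !addr0 !xy ?aA ?bA //.
  by rewrite /s /swap_sign !(agree_eq _ xy).
have [jb | nb] := eqVneq j b.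
  apply: (le_max B); rewrite ?leqnn ?orbT // => x y xy.
  rewrite jb !(ffunE, eqxx, distinct_abc) /= !mulr0 !addr0 !xy ?cB ?bB //.
  by rewrite /t /swap_sign !(agree_eq _ xy).
have [jc | nc] := eqVneq j c.
  (* Output [c] reads just two coordinates, and [A] already contains the two elements [a] and
     [b]. *)
  apply: (le_max [set a; c]).
    have -> : #|[set a; c]| = #|[set a; b]| by rewrite !cards2 eq_sym ca ab.
    by rewrite subset_leq_card // subUset !sub1set aA bA.
  move=> x y xy; rewrite jc !(ffunE, eqxx, distinct_abc) /=.
  by rewrite !xy ?inE ?eqxx ?orbT // !mulr0.
apply: (le_max [set j]); first by rewrite cards1 (cardD1 a) aA.
move=> x y xy; rewrite !ffunE (negPf na) (negPf nb) (negPf nc).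
by rewrite !mulr0 xy ?inE.
Qed.

End Construction.

Theorem theorem3 (n q : nat) (hn : (3 <= n)%N) (hq : (3 <= q)%N) (hodd : odd q) :
  exists F : network 'I_n 'I_q,
    (degree F)%:Z <= Num.ceil ((2 * n)%:R / 3 : rat) /\
    rank F = (q ^ n - 2)%N.
Proof.
(* The form [q.+2] gives the ordinal type its ring structure of integers modulo [q]. *)
case: q hq hodd => [|[|q]] // _ hodd.
have unit2 : (2 : 'I_q.+2) \is a GRing.unit.
  by rewrite (@unitZpE q.+2) // coprimen2.
pose a : 'I_n := Ordinal (ltn_trans (isT : 0 < 2)%N hn).
have b_lt : (n./2 < n)%N by lia.
have c_lt : (n.-1 < n)%N by lia.
pose b := Ordinal b_lt; pose c := Ordinal c_lt.
pose A := [set i : 'I_n | (0 <= i < n./2.+1)%N].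
pose B := [set i : 'I_n | (n./2 <= i < n)%N].
have AUB : A :|: B = setT.
  by apply/setP => i; have := ltn_ord i; rewrite !inE; lia.
have AIB : A :&: B = [set b].
  by apply/setP => i; have := ltn_ord i; rewrite !inE -val_eqE /=; lia.
have aA : a \in A by rewrite inE.
have cB : c \in B by rewrite inE /=; lia.
have ab : a != b by rewrite -val_eqE /=; lia.
have cb : c != b by rewrite -val_eqE /=; lia.
exists (@two_swaps _ 'I_q.+2 A B a b c); split; last first.
  by rewrite (rank_two_swaps unit2 AUB AIB aA cB ab cb) !card_ord.
have := degree_two_swaps 'I_q.+2 AIB aA cB ab cb.
have := card_ord_itv n 0 n./2.+1; have := card_ord_itv n n./2 n.
rewrite -/A -/B; set D := degree _ => cardB cardA leD.
(* For an integer [D], being at most the ceiling of 2n/3 means D - 1 < 2n/3, that is, 3D <= 2n + 2.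
   Both sets have at most n/2 + 1 elements, which suffices as n >= 2. *)
have {cardA cardB} leD : (3 * D <= 2 * n + 2)%N by lia.
have : (3 * D)%:R <= (2 * n + 2)%:R :> rat by rewrite ler_nat.
rewrite -ltzD1 -ltrBlDr ceil_gt_int rmorphB /= -pmulrn natrD !natrM; lra.
Qed.
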